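(* Let $(X, d_X)$, $(Y, d_Y)$ be metric spaces. For any real $\varepsilon > 2\, \mathrm{d_{GH}}(X,Y)$, the persistence modules $\mathrm{H}(\mathbb{R}\mathrm{ips}(X))$ and $\mathrm{H}(\mathbb{R}\mathrm{ips}(Y))$ are $\varepsilon$-interleaved.
   Context: Fix a field $\mathbf{k}$; $\mathrm{H}$ denotes (total) simplicial homology with coefficients in $\mathbf{k}$. A persistence module $\mathbb{V}$ is a family of $\mathbf{k}$-vector spaces $(V_a)_{a\in\mathbf{R}}$ with linear maps $v_a^b:V_a\to V_b$ for $a\le b$ such that $v_a^a=\mathrm{id}$ and $v_b^c\circ v_a^b=v_a^c$ for $a\le b\le c$. A homomorphism of degree $\varepsilon$, $\Phi\in\mathrm{Hom}^\varepsilon(\mathbb{U},\mathbb{V})$, is a family of linear maps $(\phi_a:U_a\to V_{a+\varepsilon})_{a\in\mathbf{R}}$ with $v_{a+\varepsilon}^{b+\varepsilon}\circ\phi_a=\phi_b\circ u_a^b$ for all $a\le b$. $\mathbb{U},\mathbb{V}$ are $\varepsilon$-interleaved if there are $\Phi\in\mathrm{Hom}^\varepsilon(\mathbb{U},\mathbb{V})$, $\Psi\in\mathrm{Hom}^\varepsilon(\mathbb{V},\mathbb{U})$ with $\psi_{a+\varepsilon}\circ\phi_a=u_a^{a+2\varepsilon}$ and $\phi_{a+\varepsilon}\circ\psi_a=v_a^{a+2\varepsilon}$ for all $a$. A correspondence $C:X\rightrightarrows Y$ is a subset of $X\times Y$ projecting surjectively onto both $X$ and $Y$; its distortion is $\mathrm{dis}(C)=\sup\{|d_X(x,x')-d_Y(y,y')|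 : (x,y),(x',y')\in C\}$ (with $\sup\emptyset=0$). The Gromov--Hausdorff distance is $\mathrm{d_{GH}}(X,Y)=\frac12\inf\{\mathrm{dis}(C): C \text{ a correspondence } X\rightrightarrows Y\}\in[0,+\infty]$. For a metric space $(X,d_X)$ and $a\in\mathbf{R}$, the Vietoris--Rips complex $\mathrm{Rips}(X,a)$ is the simplicial complex whose simplices are the nonempty finite subsets $\{x_0,\dots,x_k\}\subseteq X$ with $d_X(x_i,x_j)\le a$ for all $i,j$ (including $i=j$; so it is empty for $a<0$). $\mathbb{R}\mathrm{ips}(X)$ is the filtered complex $(\mathrm{Rips}(X,a))_{a\in\mathbf{R}}$, and $\mathrm{H}(\mathbb{R}\mathrm{ips}(X))$ is the persistence module $(\mathrm{H}(\mathrm{Rips}(X,a)))_{a}$ with maps induced by inclusions. *)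

(* Defs.v *)
From HB Require Import structures.
(* freeg is imported first because it shadows fintype.lift. *)
From mathcomp Require Import freeg.
From mathcomp Require Import all_boot all_order all_algebra.
From mathcomp Require Import perm finmap generic_quotient.
From mathcomp Require Import boolp classical_sets reals ereal metric_structure.

Set Implicit Arguments.
Unset Strict Implicit.
Unset Printing Implicit Defensive.

Import Order.TTheory GRing.Theory Num.Theory.
Local Open Scope classical_set_scope.
Local Open Scope ring_scope.
Local Open Scope quotient_scope.

Section Submodule.
Variables (k : fieldType) (V : lmodType k).

Record submodule := Submodule {
  submod_pred :> {pred V};
  submod_predP : GRing.submod_closed submod_pred }.

Fact submodule_closed (S : submodule) : GRing.subsemimod_closed S.
Proof. exact: GRing.submod_closed_semi (submod_predP S). Qed.

HB.instance Definition _ (S : submodule) :=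
  GRing.isSubmodClosed.Build k V (submod_pred S) (submodule_closed S).

Record submod (S : submodule) := Submod {
  submod_val :> V;
  submod_valP : submod_val \in S }.

HB.instance Definition _ S := [isSub for @submod_val S].
HB.instance Definition _ S := [Choice of submod S by <:].
HB.instance Definition _ S := [SubChoice_isSubLmodule of submod S by <:].

Fact mod_span_closed (A : set V) : GRing.submod_closed
  [pred v : V | `[< forall S : submodule, A `<=` [set` S] -> v \in S >]].
Proof.
split=> [|a u v]; first by apply: asboolT => S _; exact: rpred0.
move=> /asboolW Su /asboolW Sv; apply: asboolT => S AS.
by rewrite rpredD ?rpredZ ?Su ?Sv.
Qed.

Definition mod_span (A : set V) : submodule := Submodule (mod_span_closed A).

Definition quotmod (S : submodule) : Type := Quotient.quot S.

HB.instance Definition _ S := GRing.Zmodule.on (quotmod S).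
HB.instance Definition _ S := EqQuotient.on (quotmod S).

Definition quotmod_scale (S : submodule) (a : k) (x : quotmod S) : quotmod S :=
  \pi_(quotmod S) (a *: repr x).

Section QuotmodTheory.
Variable S : submodule.
Local Notation pi := (\pi_(quotmod S)).

Lemma quotmod_eqE (x y : V) : (pi x == pi y) = (x - y \in S).
Proof. by rewrite Quotient.idealrBE. Qed.

Lemma quotmod_repr (x : V) : repr (pi x) - x \in S.
Proof. by rewrite -quotmod_eqE reprK. Qed.

Lemma quotmod_piD : {morph pi : x y / x + y}.
Proof. exact: (@Quotient.pi_add _ S). Qed.

Local Notation scale := (@quotmod_scale S).

Lemma quotmod_scaleE a x : scale a (pi x) = pi (a *: x).
Proof. by apply/eqP; rewrite quotmod_eqE -scalerBr rpredZ// quotmod_repr. Qed.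

Fact quotmod_scaleA a b x :
  scale a (scale b x) = scale (a * b) x.
Proof. by rewrite -[x]reprK (quotmod_scaleE b) !quotmod_scaleE scalerA. Qed.

Fact quotmod_scale1 : left_id 1 scale.
Proof. by move=> x; rewrite -[x]reprK quotmod_scaleE scale1r. Qed.

Fact quotmod_scaleDr : right_distributive scale +%R.
Proof.
move=> a x y; rewrite -[x]reprK -[y]reprK -quotmod_piD !quotmod_scaleE.
by rewrite scalerDr quotmod_piD.
Qed.

Fact quotmod_scaleDl x : {morph scale^~ x : a b / a + b}.
Proof.
by move=> a b; rewrite -[x]reprK !quotmod_scaleE scalerDl quotmod_piD.
Qed.

HB.instance Definition _ := GRing.Zmodule_isLmodule.Build k (quotmod S)
  quotmod_scaleA quotmod_scale1 quotmod_scaleDr quotmod_scaleDl.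

Definition quot_proj (x : V) : quotmod S := pi x.

Fact quot_proj_is_linear : linear quot_proj.
Proof. by move=> a x y; rewrite /quot_proj quotmod_piD -quotmod_scaleE. Qed.

HB.instance Definition _ :=
  GRing.isLinear.Build k V (quotmod S) _ quot_proj quot_proj_is_linear.

Lemma quot_proj_surj (x : quotmod S) : exists v, x = quot_proj v.
Proof. by exists (repr x); rewrite /quot_proj reprK. Qed.

Lemma quot_proj_eq (x y : V) : (quot_proj x == quot_proj y) = (x - y \in S).
Proof. exact: quotmod_eqE. Qed.

Lemma quot_proj_eq0 (x : V) : (quot_proj x == 0) = (x \in S).
Proof. by rewrite -[0](linear0 quot_proj) quot_proj_eq subr0. Qed.

End QuotmodTheory.
End Submodule.

Section InducedMaps.
Variables (k : fieldType) (V W : lmodType k).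

Definition submod_map (S : submodule V) (T : submodule W)
    (f : {linear V -> W}) (fST : forall v, v \in S -> f v \in T)
    (x : submod S) : submod T :=
  Submod (fST (submod_val x) (submod_valP x)).

Fact submod_map_is_linear S T f fST : linear (@submod_map S T f fST).
Proof. by move=> a x y; apply: val_inj; rewrite /= linearP. Qed.

HB.instance Definition _ S T f fST :=
  GRing.isLinear.Build k (submod S) (submod T) _
    (@submod_map S T f fST) (submod_map_is_linear fST).

(* The map V / S -> W induced by f; the choice of the representative
   is immaterial by quot_liftE. *)
Definition quot_lift (S : submodule V) (f : {linear V -> W})
    (fS0 : forall v, v \in S -> f v = 0) (x : quotmod S) : W :=
  f (repr x).

Lemma quot_liftE S f fS0 v : @quot_lift S f fS0 (quot_proj S v) = f v.
Proof.
by apply/eqP; rewrite -subr_eq0 -linearB; apply/eqP/fS0/quotmod_repr.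
Qed.

Fact quot_lift_is_linear S f fS0 : linear (@quot_lift S f fS0).
Proof.
move=> a x y; case: (quot_proj_surj x) (quot_proj_surj y) => [u ->] [v ->].
by rewrite -linearP !quot_liftE linearP.
Qed.

HB.instance Definition _ S f fS0 := GRing.isLinear.Build k (quotmod S) W _
  (@quot_lift S f fS0) (quot_lift_is_linear fS0).

End InducedMaps.

Section FreeModule.
Variables (k : fieldType) (K : choiceType).

Section Lift.
Variables (V : lmodType k) (f : K -> V).

Local Notation lift := (fglift f : {freeg K / k} -> V).

HB.instance Definition _ := GRing.isZmodMorphism.Build {freeg K / k} V
  (fglift f) (lift_is_additive f).

Fact fglift_is_scalable : scalable lift.
Proof.
move=> a; elim/freeg_ind_dom0 => [|b x D _ _ IH].
  by rewrite scaler0 raddf0 scaler0.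
have -> : a *: (<<b *g x>> + D) = << a * b *g x >> + a *: D.
  rewrite scalerDr; congr (_ + _); apply/eqP/freeg_eqP => y.
  by rewrite coeffZ !coeffU mulrA.
by rewrite !raddfD /= !liftU IH scalerA.
Qed.

HB.instance Definition _ := GRing.isScalable.Build k {freeg K / k} V _
  (fglift f) fglift_is_scalable.

Lemma fgliftU x : fglift f (<< x >> : {freeg K / k}) = f x.
Proof. by rewrite liftU scale1r. Qed.

End Lift.

Lemma freeg_linear_ext (V : lmodType k) (g h : {linear {freeg K / k} -> V}) :
  (forall x, g << x >> = h << x >>) -> g =1 h.
Proof.
move=> gh; elim/freeg_ind_dom0 => [|a x D _ _ IH]; first by rewrite !linear0.
have -> : << a *g x >> = a *: << x >> :> {freeg K / k}.
  by apply/eqP/freeg_eqP => y; rewrite coeffZ !coeffU mul1r.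
by rewrite !linearD !linearZ /= gh IH.
Qed.

End FreeModule.

Section SimplicialComplex.

Record scomplex (X : choiceType) := SComplex {
  simplices : set {fset X};
  simplex_neq0 : forall s, simplices s -> s != fset0;
  simplex_sub : forall s t : {fset X},
    simplices s -> t != fset0 -> (t `<=` s)%fset -> simplices t }.

Variables (X : choiceType) (K : scomplex X).

Definition vertices n (t : {ffun 'I_n -> X}) : {fset X} :=
  [fset t i | i in 'I_n]%fset.

(* An ordered n-simplex of K: a sequence (x_0, ..., x_n) of possibly repeated
   vertices whose underlying set is a simplex of K. *)
Record osimplex n := OSimplex {
  osimplex_val :> {ffun 'I_n.+1 -> X};
  osimplexP : vertices osimplex_val \in simplices K }.

HB.instance Definition _ n := [isSub for @osimplex_val n].
HB.instance Definition _ n := [Choice of osimplex n by <:].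

Lemma mem_vertices n (t : {ffun 'I_n -> X}) i : t i \in vertices t.
Proof. by apply/imfsetP; exists i. Qed.

Lemma vertices_neq0 n (t : {ffun 'I_n.+1 -> X}) : vertices t != fset0.
Proof. by apply/fset0Pn; exists (t ord0); exact: mem_vertices. Qed.

Fact osimplex_reindexP m n (t : osimplex n) (h : 'I_m.+1 -> 'I_n.+1) :
  vertices [ffun i => t (h i)] \in simplices K.
Proof.
apply/mem_set; apply: simplex_sub (set_mem (osimplexP t)) _ _.
  exact: vertices_neq0.
apply/fsubsetP => x /imfsetP[i _ ->]; rewrite ffunE; exact: mem_vertices.
Qed.

Definition osimplex_reindex m n (t : osimplex n) (h : 'I_m.+1 -> 'I_n.+1) :
  osimplex m := OSimplex (osimplex_reindexP t h).

Definition face n (t : osimplex n.+1) (i : 'I_n.+2) : osimplex n :=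
  osimplex_reindex t (lift i).

Definition operm n (t : osimplex n) (s : 'S_n.+1) : osimplex n :=
  osimplex_reindex t s.

Lemma osimplex_reindex_comp m n p (t : osimplex p) (h : 'I_n.+1 -> 'I_p.+1)
    (g : 'I_m.+1 -> 'I_n.+1) :
  osimplex_reindex (osimplex_reindex t h) g = osimplex_reindex t (h \o g).
Proof. by apply: val_inj; apply/ffunP => i; rewrite !ffunE. Qed.

Lemma eq_osimplex_reindex m n (t : osimplex n) (g h : 'I_m.+1 -> 'I_n.+1) :
  g =1 h -> osimplex_reindex t g = osimplex_reindex t h.
Proof. by move=> gh; apply: val_inj; apply/ffunP => i; rewrite !ffunE gh. Qed.

Definition osimplices := {n : nat & osimplex n}.

End SimplicialComplex.

Section Chains.
Variables (k : fieldType) (X : choiceType) (K : scomplex X).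

Definition free_chains := {freeg (osimplices K) / k}.

Definition ordered n (t : osimplex K n) : free_chains := << Tagged _ t >>.

Definition orientation_relations : set free_chains :=
  [set c | exists n (t : osimplex K n), ~~ injectiveb t /\ c = ordered t] `|`
  [set c | exists n (t : osimplex K n) (s : 'S_n.+1),
     c = ordered (operm t s) - (-1) ^+ s *: ordered t].

(* The direct sum over n of the spaces of oriented simplicial n-chains. *)
Definition chains := quotmod (mod_span orientation_relations).

HB.instance Definition _ := GRing.Lmodule.on free_chains.
HB.instance Definition _ := GRing.Lmodule.on chains.

(* The oriented simplex [t_0, ..., t_n]. *)
Definition oriented n (t : osimplex K n) : chains :=
  quot_proj (mod_span orientation_relations) (ordered t).

Lemma oriented_degenerate n (t : osimplex K n) :
  ~~ injectiveb t -> oriented t = 0.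
Proof.
move=> tN; apply/eqP; rewrite quot_proj_eq0; apply: asboolT => S; apply.
by left; exists n, t.
Qed.

Lemma oriented_perm n (t : osimplex K n) (s : 'S_n.+1) :
  oriented (operm t s) = (-1) ^+ s *: oriented t.
Proof.
rewrite /oriented -linearZ; apply/eqP; rewrite quot_proj_eq.
by apply: asboolT => S; apply; right; exists n, t, s.
Qed.

Section Lift.
Variables (V : lmodType k) (g : forall n, osimplex K n -> V).
Hypothesis g_degenerate : forall n (t : osimplex K n),
  ~~ injectiveb t -> g t = 0.
Hypothesis g_perm : forall n (t : osimplex K n) (s : 'S_n.+1),
  g (operm t s) = (-1) ^+ s *: g t.

Definition free_chains_lift : free_chains -> V :=
  fglift (fun u : osimplices K => g (tagged u)).

HB.instance Definition _ := GRing.Linear.on free_chains_lift.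

Lemma free_chains_liftE n (t : osimplex K n) :
  free_chains_lift (ordered t) = g t.
Proof. exact: fgliftU. Qed.

Fact free_chains_lift_ker_closed :
  GRing.submod_closed [pred c | free_chains_lift c == 0].
Proof.
split=> [|a u v]; rewrite !inE ?linear0// linearP /=.
by move=> /eqP-> /eqP->; rewrite scaler0 addr0.
Qed.

Fact chains_lift_subproof c :
  c \in mod_span orientation_relations -> free_chains_lift c = 0.
Proof.
move=> /asboolW /(_ (Submodule free_chains_lift_ker_closed)) c0.
apply/eqP/c0 => {c c0} c [[n [t [tN ->]]]|[n [t [s ->]]]] /=.
  by rewrite inE free_chains_liftE g_degenerate.
by rewrite inE linearB linearZ /= !free_chains_liftE g_perm subrr.
Qed.

Definition chains_lift : chains -> V := quot_lift chains_lift_subproof.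

HB.instance Definition _ := GRing.Linear.on chains_lift.

Lemma chains_liftE n (t : osimplex K n) : chains_lift (oriented t) = g t.
Proof. by rewrite /chains_lift quot_liftE /= free_chains_liftE. Qed.

End Lift.

Lemma chains_linear_ext (V : lmodType k) (f g : {linear chains -> V}) :
  (forall n (t : osimplex K n), f (oriented t) = g (oriented t)) -> f =1 g.
Proof.
move=> fg c; have [v ->] := quot_proj_surj c.
pose p := @quot_proj k _ (mod_span orientation_relations).
by apply: (@freeg_linear_ext _ _ _ (f \o p) (g \o p)) => -[n t]; exact: fg.
Qed.

(* The boundary of a vertex is 0: homology is not reduced. *)
Definition oboundary n : osimplex K n -> chains :=
  match n return osimplex K n -> chains with
  | 0 => fun _ => 0
  | m.+1 => fun t => \sum_(i < m.+2) (-1) ^+ i *: oriented (face t i)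
  end.

Lemma lift_perm_ex n (s : 'S_n.+1) i :
  exists s' : 'S_n, s = lift_perm i (s i) s'.
Proof.
have sN j : {j' | s (lift i j) = lift (s i) j'}.
  have: s i != s (lift i j) by rewrite (inj_eq perm_inj) neq_lift.
  by case/unlift_some => j' ? _; exists j'.
have inj : injective (fun j => sval (sN j)).
  move=> j1 j2 /(congr1 (lift (s i))); rewrite -!(svalP (sN _)).
  by move/perm_inj/lift_inj.
exists (perm inj); apply/permP => j.
have [j'|]:= unliftP i j; move=> ->; last by rewrite lift_perm_id.
by rewrite lift_perm_lift permE -(svalP (sN _)).
Qed.

Lemma oriented_face_perm n (t : osimplex K n.+1) (s : 'S_n.+2) i :
  oriented (face (operm t s) i) =
  (-1) ^+ (odd i (+) odd (s i) (+) s) *: oriented (face t (s i)).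
Proof.
have [s' sE] := lift_perm_ex s i.
have -> : face (operm t s) i = operm (face t (s i)) s'.
  rewrite /face /operm !osimplex_reindex_comp.
  by apply: eq_osimplex_reindex => j /=; rewrite {1}sE lift_perm_lift.
rewrite oriented_perm; congr (_ ^+ _ *: _).
have := odd_lift_perm i (s i) s'; rewrite -sE => ->.
by case: (odd i); case: (odd (s i)); case: (s' : bool).
Qed.

Fact oboundary_perm n (t : osimplex K n) (s : 'S_n.+1) :
  oboundary (operm t s) = (-1) ^+ s *: oboundary t.
Proof.
case: n => [|n] in t s *; first by rewrite /= scaler0.
rewrite /= scaler_sumr [RHS](reindex_inj (@perm_inj _ s)) /=.
apply: eq_bigr => i _; rewrite oriented_face_perm !scalerA; congr (_ *: _).
rewrite -(signr_odd _ i) -(signr_odd _ (s i)).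
by case: (odd i); case: (odd (s i)); case: (s : bool);
  rewrite /= ?(expr0, expr1, mulr1, mul1r, mulrNN).
Qed.

Fact oboundary_degenerate n (t : osimplex K n) :
  ~~ injectiveb t -> oboundary t = 0.
Proof.
case: n => [|n] in t *.
  by move=> /injectivePn[i [j /eqP]]; rewrite !ord1.
move=> /injectivePn[i [j ij tij]] /=.
rewrite (bigD1 i)//= (bigD1 j) /=; last by rewrite eq_sym.
rewrite big1 => [|l /andP[li lj]]; last first.
  rewrite oriented_degenerate ?scaler0//; apply/injectivePn.
  have [i' iE _] := unlift_some li; have [j' jE _] := unlift_some lj.
  exists i', j'; last by rewrite !ffunE -iE -jE.
  by apply: contraNneq ij => i'j'; rewrite iE jE i'j'.
have tE : operm t (tperm i j) = t.
  apply: val_inj; apply/ffunP => l; rewrite ffunE.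
  by case: tpermP => [->|->|].
rewrite addr0 -[t in face t i]tE oriented_face_perm tpermL odd_tperm ij.
rewrite scalerA -scalerDl -(signr_odd _ i) -(signr_odd _ j).
by case: (odd i); case: (odd j);
  rewrite /= ?(expr0, expr1, mulr1, mul1r, mulrNN, addNr, subrr, scale0r).
Qed.

Definition boundary : chains -> chains :=
  chains_lift oboundary_degenerate oboundary_perm.

HB.instance Definition _ := GRing.Linear.on boundary.

Lemma boundaryE n (t : osimplex K n) : boundary (oriented t) = oboundary t.
Proof. exact: chains_liftE. Qed.

Lemma face_face n (t : osimplex K n.+2) (i : 'I_n.+3) (j : 'I_n.+2) :
  (j < i)%N -> face (face t i) j = face (face t (inord j)) (inord i.-1).
Proof.
move=> ji; rewrite /face !osimplex_reindex_comp.
apply: eq_osimplex_reindex => l /=; apply: val_inj => /=.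
have i0 : (0 < i)%N by apply: leq_ltn_trans ji.
have jn : (j < n.+3)%N by rewrite ltnS ltnW.
have i1 : (i.-1 < n.+2)%N by rewrite -ltnS prednK.
have ij : bump i j = j by rewrite /bump leqNgt ji.
have ji1 : unbump j i = i.-1 by rewrite /unbump ji subn1.
by rewrite !inordK// [LHS]bumpC ij ji1.
Qed.

Fact boundaryK (c : chains) : boundary (boundary c) = 0.
Proof.
apply: (@chains_linear_ext _ (boundary \o boundary) \0) => -[|[|n]] t /=;
  rewrite boundaryE /= ?linear0// linear_sum /=.
  by rewrite big1// => i _; rewrite linearZ /= boundaryE scaler0.
under eq_bigr => i _.
  rewrite linearZ /= boundaryE /= scaler_sumr.
  under eq_bigr do rewrite scalerA -exprD.
  over.
rewrite pair_big /= (bigID (fun p : 'I_n.+3 * 'I_n.+2 => p.2 < p.1)%N) /=.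
apply/eqP; rewrite addr_eq0 -sumrN; apply/eqP.
rewrite [RHS](reindex_onto 
  (fun p : 'I_n.+3 * 'I_n.+2 => (inord p.2, inord p.1.-1))
  (fun p : 'I_n.+3 * 'I_n.+2 => (inord p.2.+1, inord p.1))) /=; last first.
  move=> [i j] /=; rewrite -leqNgt => ij.
  have jn : (j.+1 < n.+3)%N by rewrite ltnS.
  have im : (i < n.+2)%N by apply: leq_ltn_trans (ltn_ord j).
  by rewrite !inordK//= !inord_val.
apply: eq_big => [[i j]|[i j]] /=.
  have jn : (j < n.+3)%N by rewrite ltnS ltnW.
  have [i0|i0] := posnP i.
    rewrite i0 /= ltn0; apply/esym/negbTE; rewrite negb_and; apply/orP; right.
    by apply/eqP => -[/(congr1 val)]; rewrite /= !inordK// i0.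
  have i1 : (i.-1 < n.+2)%N by rewrite -ltnS prednK.
  have -> : (inord (inord i.-1 : 'I_n.+2).+1, inord (inord j : 'I_n.+3)) = (i, j)
      :> 'I_n.+3 * 'I_n.+2.
    by rewrite !inordK// prednK// !inord_val.
  by rewrite eqxx andbT !inordK// -leqNgt -[in RHS]ltnS prednK.
move=> ji; rewrite (face_face _ ji) -scaleNr; congr (_ *: _).
have jn : (j < n.+3)%N by rewrite ltnS ltnW.
have i0 : (0 < i)%N by apply: leq_ltn_trans ji.
have i1 : (i.-1 < n.+2)%N by rewrite -ltnS prednK.
rewrite !inordK//.
by rewrite -[X in (X + j)%N](prednK i0) addSn exprS mulN1r addnC.
Qed.

End Chains.

Section Homology.
Variables (k : fieldType) (X : choiceType) (K : scomplex X).
Local Notation chains := (chains k K).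

Fact cycles_closed : GRing.submod_closed [pred c : chains | boundary c == 0].
Proof.
split=> [|a u v]; rewrite !inE ?linear0// linearP /=.
by move=> /eqP-> /eqP->; rewrite scaler0 addr0.
Qed.

Definition cycles : submodule chains := Submodule cycles_closed.

Fact boundaries_closed : GRing.submod_closed
  [pred z : submod cycles | `[< exists c, submod_val z = boundary c >]].
Proof.
split=> [|a u v]; first by apply: asboolT; exists 0; rewrite linear0.
move=> /asboolW[c uE] /asboolW[d vE]; apply: asboolT.
by exists (a *: c + d); rewrite linearP /= -uE -vE.
Qed.

Definition boundaries : submodule (submod cycles) :=
  Submodule boundaries_closed.

(* Total homology: the direct sum of the homology spaces of all degrees. *)
Definition homology := quotmod boundaries.

HB.instance Definition _ := GRing.Lmodule.on homology.

Definition homology_class (z : submod cycles) : homology :=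
  quot_proj boundaries z.

Fact homology_class_is_linear : linear homology_class.
Proof. exact: quot_proj_is_linear. Qed.

HB.instance Definition _ := GRing.isLinear.Build k (submod cycles) homology _
  homology_class homology_class_is_linear.

Lemma homology_class_surj (h : homology) : exists z, h = homology_class z.
Proof. exact: quot_proj_surj. Qed.

Lemma homology_class_eqP (z z' : submod cycles) :
  (exists c, submod_val z - submod_val z' = boundary c) <->
  homology_class z = homology_class z'.
Proof.
split=> [zz'|/eqP]; last by rewrite quot_proj_eq => /asboolW.
by apply/eqP; rewrite quot_proj_eq; exact: asboolT.
Qed.

End Homology.

Section SimplicialMaps.
Variables (k : fieldType) (X Y : choiceType).
Variables (K : scomplex X) (L : scomplex Y).

Definition simplicial (f : X -> Y) :=
  forall s : {fset X}, simplices K s -> simplices L (f @` s)%fset.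

Variables (f : X -> Y) (fP : simplicial f).

Fact osimplex_map_subproof n (t : osimplex K n) :
  vertices [ffun i => f (t i)] \in simplices L.
Proof.
have -> : vertices [ffun i => f (t i)] = (f @` vertices t)%fset.
  apply/fsetP => y; apply/imfsetP/imfsetP => /= -[].
    move=> i _ ->; rewrite ffunE; exists (t i) => //; exact: mem_vertices.
  by move=> _ /imfsetP[i _ ->] ->; exists i; rewrite ?ffunE.
by apply/mem_set/fP/set_mem/osimplexP.
Qed.

Definition osimplex_map n (t : osimplex K n) : osimplex L n :=
  OSimplex (osimplex_map_subproof t).

Lemma osimplex_map_reindex m n (t : osimplex K n) (h : 'I_m.+1 -> 'I_n.+1) :
  osimplex_map (osimplex_reindex t h) = osimplex_reindex (osimplex_map t) h.
Proof. by apply: val_inj; apply/ffunP => i; rewrite !ffunE. Qed.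

Fact oriented_map_degenerate n (t : osimplex K n) :
  ~~ injectiveb t -> oriented k (osimplex_map t) = 0.
Proof.
move=> /injectivePn[i [j ij tij]]; apply: oriented_degenerate.
by apply/injectivePn; exists i, j; rewrite // !ffunE tij.
Qed.

Fact oriented_map_perm n (t : osimplex K n) (s : 'S_n.+1) :
  oriented k (osimplex_map (operm t s)) =
  (-1) ^+ s *: oriented k (osimplex_map t).
Proof. by rewrite osimplex_map_reindex -oriented_perm. Qed.

(* [x_0, ..., x_n] |-> [f x_0, ..., f x_n] *)
Definition chain_map : chains k K -> chains k L :=
  chains_lift oriented_map_degenerate oriented_map_perm.

HB.instance Definition _ := GRing.Linear.on chain_map.

Lemma chain_mapE n (t : osimplex K n) :
  chain_map (oriented k t) = oriented k (osimplex_map t).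
Proof. exact: chains_liftE. Qed.

Lemma boundary_chain_map c :
  boundary (chain_map c) = chain_map (boundary c).
Proof.
move: c; apply: (@chains_linear_ext _ _ _ _
  (@boundary k Y L \o chain_map) (chain_map \o @boundary k X K)) => n t /=.
rewrite chain_mapE !boundaryE; case: n => [|n] in t *; first by rewrite linear0.
rewrite /= linear_sum /=; apply: eq_bigr => i _.
by rewrite linearZ /= chain_mapE osimplex_map_reindex.
Qed.

Fact chain_map_cycle c : c \in cycles k K -> chain_map c \in cycles k L.
Proof. by rewrite !inE boundary_chain_map => /eqP->; rewrite linear0. Qed.

Definition cycle_map : submod (cycles k K) -> submod (cycles k L) :=
  submod_map chain_map_cycle.

HB.instance Definition _ := GRing.Linear.on cycle_map.

Fact cycle_map_boundary z :
  z \in boundaries k K -> homology_class (cycle_map z) = 0.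
Proof.
move=> /asboolW[c zE]; apply/eqP; rewrite quot_proj_eq0; apply: asboolT.
by exists (chain_map c); rewrite boundary_chain_map -zE.
Qed.

Definition homology_map : homology k K -> homology k L :=
  @quot_lift _ _ _ _ (@homology_class k Y L \o cycle_map) cycle_map_boundary.

HB.instance Definition _ := GRing.Linear.on homology_map.

Lemma homology_mapE z :
  homology_map (homology_class z) = homology_class (cycle_map z).
Proof. exact: quot_liftE. Qed.

End SimplicialMaps.

Arguments chain_map k {X Y K L f} fP.
Arguments homology_map k {X Y K L f} fP.

Lemma homology_map_id (k : fieldType) (X : choiceType) (K : scomplex X)
    (f : X -> X) (fP : simplicial K K f) :
  f =1 id -> homology_map k fP =1 id.
Proof.
move=> fid h; have [z ->] := homology_class_surj h; rewrite homology_mapE.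
congr homology_class; apply: val_inj; rewrite /=.
apply: (@chains_linear_ext _ _ _ _ (chain_map k fP) idfun) => n t /=.
rewrite chain_mapE; congr oriented; apply: val_inj; apply/ffunP => i.
by rewrite ffunE.
Qed.

Lemma homology_map_comp (k : fieldType) (X Y Z : choiceType) (K : scomplex X)
    (L : scomplex Y) (M : scomplex Z) (f : X -> Y) (g : Y -> Z) (e : X -> Z)
    (fP : simplicial K L f) (gP : simplicial L M g) (eP : simplicial K M e) :
  g \o f =1 e -> homology_map k gP \o homology_map k fP =1 homology_map k eP.
Proof.
move=> gf h; have [z ->] := homology_class_surj h; rewrite /= !homology_mapE.
congr homology_class; apply: val_inj; rewrite /=.
apply: (@chains_linear_ext _ _ _ _ (chain_map k gP \o chain_map k fP)
  (chain_map k eP)) => n t /=.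
rewrite !chain_mapE; congr oriented; apply: val_inj; apply/ffunP => i.
by rewrite !ffunE -gf.
Qed.

Section Inclusion.
Variables (k : fieldType) (X : choiceType) (K L : scomplex X).
Hypothesis KL : simplices K `<=` simplices L.

Fact simplicial_id : simplicial K L id.
Proof. by move=> s Ks; rewrite imfset_id; exact: KL. Qed.

Definition homology_incl : homology k K -> homology k L :=
  homology_map k simplicial_id.

HB.instance Definition _ := GRing.Linear.on homology_incl.

End Inclusion.

Arguments homology_incl k {X K L} KL.

Section Persistence.
Variables (R : realType) (k : fieldType).

Record persmod := PersMod {
  pm_space :> R -> lmodType k;
  pm_map : forall a b : R, a <= b -> {linear pm_space a -> pm_space b};
  pm_map_id : forall (a : R) (aa : a <= a) v, pm_map aa v = v;
  pm_map_comp : forall (a b c : R) (ab : a <= b) (bc : b <= c) (ac : a <= c) v,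
    pm_map bc (pm_map ab v) = pm_map ac v }.

Arguments pm_map p {a b} ab.

Record pm_hom (e : R) (U V : persmod) := PmHom {
  pm_hom_fun :> forall a, {linear U a -> V (a + e)};
  pm_hom_natural : forall (a b : R) (ab : a <= b) (ab_e : a + e <= b + e) u,
    pm_map V ab_e (pm_hom_fun a u) = pm_hom_fun b (pm_map U ab u) }.

(* a + e + e stands for a + 2 e. *)
Definition interleaved (e : R) (U V : persmod) : Prop :=
  0 <= e /\
  exists (Phi : pm_hom e U V) (Psi : pm_hom e V U),
    (forall (a : R) (a2e : a <= a + e + e) u, Psi (a + e) (Phi a u) = pm_map U a2e u)
    /\
    (forall (a : R) (a2e : a <= a + e + e) v, Phi (a + e) (Psi a v) = pm_map V a2e v).

Record filtered_complex (X : choiceType) := FilteredComplex {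
  fc_complex :> R -> scomplex X;
  fc_mono : forall a b : R, a <= b ->
    simplices (fc_complex a) `<=` simplices (fc_complex b) }.

Arguments fc_mono {X} f {a b} ab.

Section HomologyPersmod.
Variables (X : choiceType) (F : filtered_complex X).

Definition homology_pm_map a b (ab : a <= b) :
    {linear homology k (F a) -> homology k (F b)} :=
  homology_incl k (fc_mono F ab).

Fact homology_pm_map_id a (aa : a <= a) v : homology_pm_map aa v = v.
Proof. exact: homology_map_id. Qed.

Fact homology_pm_map_comp a b c (ab : a <= b) (bc : b <= c) (ac : a <= c) v :
  homology_pm_map bc (homology_pm_map ab v) = homology_pm_map ac v.
Proof. exact: homology_map_comp. Qed.

Definition homology_persmod : persmod :=
  @PersMod (fun a => homology k (F a)) homology_pm_map
    homology_pm_map_id homology_pm_map_comp.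

End HomologyPersmod.
End Persistence.

Section Rips.
Variables (R : realType) (X : metricType R).

Definition rips_simplices (a : R) : set {fset X} :=
  [set s | s != fset0 /\ {in s &, forall x y, mdist x y <= a}].

Fact rips_neq0 a (s : {fset X}) : rips_simplices a s -> s != fset0.
Proof. by case. Qed.

Fact rips_sub a (s t : {fset X}) : rips_simplices a s -> t != fset0 ->
  (t `<=` s)%fset -> rips_simplices a t.
Proof.
by move=> [_ sa] t0 /fsubsetP ts; split=> // x y /ts xs /ts ys; exact: sa.
Qed.

Definition rips (a : R) : scomplex X := SComplex (@rips_neq0 a) (@rips_sub a).

Fact rips_mono (a b : R) : a <= b -> simplices (rips a) `<=` simplices (rips b).
Proof.
by move=> ab s [s0 sa]; split=> // x y xs ys; exact: le_trans (sa x y xs ys) ab.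
Qed.

Definition filtered_rips : filtered_complex R X := FilteredComplex rips_mono.

End Rips.

Section GromovHausdorff.
Variables (R : realType) (X Y : metricType R).
Local Open Scope ereal_scope.

Definition correspondence (C : set (X * Y)) : Prop :=
  (forall x, exists y, C (x, y)) /\ (forall y, exists x, C (x, y)).

(* The supremum is taken in [0, +oo]: adjoining 0 makes it 0 when C is empty. *)
Definition distortion (C : set (X * Y)) : \bar R :=
  ereal_sup (0 |` [set `|mdist p.1 q.1 - mdist p.2 q.2|%R%:E | p in C & q in C]).

Definition dGH : \bar R :=
  (2^-1)%:E * ereal_inf [set distortion C | C in correspondence].

End GromovHausdorff.

(* Main.v *)
Require Import Defs.
From HB Require Import structures.
From mathcomp Require Import freeg.
From mathcomp Require Import all_boot all_order all_algebra.
From mathcomp Require Import perm finmap.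
From mathcomp Require Import boolp classical_sets.
From mathcomp Require Import reals ereal metric_structure.

Set Implicit Arguments.
Unset Strict Implicit.
Unset Printing Implicit Defensive.

Import Order.TTheory GRing.Theory Num.Theory.
Local Open Scope ring_scope.

(** A correspondence [C] of distortion less than [e] is total on both sides, so
    it contains the graph of a map [f : X -> Y] and the transpose of the graph
    of a map [g : Y -> X].  Both maps increase distances by at most [e], hence
    carry simplices at scale [a] to simplices at scale [a + e] and induce
    homomorphisms of degree [e]; these commute with the structure maps since
    homology is a functor.  The point is that [g \o f] and the inclusion induce
    the same map from scale [a] to scale [a + 2 e].  By [distortion_le], applied
    to the pairs [(x, f x)] and [(g (f x'), f x')] of [C], the two simplicial
    maps are contiguous: together, the images of a simplex span a simplex.  So
    everything rests on [homology_map_contiguous]: contiguous maps induce the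
    same map in homology.

    The usual prism operator, the alternating sum of the simplices
    [[f x_0, ..., f x_i, g x_i, ..., g x_n]], depends on the order of the
    vertices and does not descend to oriented chains.  The proof instead
    replaces [f] by [g] at one vertex at a time.  If [f] and [g] differ only at
    the vertex [v], then the operator sending an oriented simplex [t] to
    [- [g v, f t_0, ..., f t_n]] if [v] is a vertex of [t], and to [0]
    otherwise, is compatible with permutations of the vertices, and it is a
    chain homotopy from [f] to [g] ([prism_homotopy]).  Although [f] and [g] may
    differ at infinitely many vertices, a given cycle involves only finitely
    many of them ([chain_map_finite_support]), so that finitely many such
    replacements suffice; all the intermediate maps take their values among
    those of [f] and [g], so contiguity is preserved
    ([contiguous_between]). *)

(** * Contiguous simplicial maps *)

Lemma verticesP (X : choiceType) n (t : {ffun 'I_n -> X}) x :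
  reflect (exists i, t i = x) (x \in vertices t).
Proof.
apply: (iffP idP) => [/imfsetP[i _ ->]|[i <-]]; first by exists i.
exact: mem_vertices.
Qed.

Section Contiguity.
Variables (X Y : choiceType) (K : scomplex X) (L : scomplex Y).

Definition contiguous (f g : X -> Y) : Prop :=
  forall s : {fset X}, simplices K s -> simplices L (f @` s `|` g @` s)%fset.

Lemma contiguous_between f g f' g' : contiguous f g ->
  (forall x, f' x = f x \/ f' x = g x) ->
  (forall x, g' x = f x \/ g' x = g x) -> contiguous f' g'.
Proof.
move=> fg f'fg g'fg s Ks; apply: simplex_sub (fg s Ks) _ _.
  have /fset0Pn[x xs] := simplex_neq0 Ks.
  by apply/fset0Pn; exists (f' x); rewrite in_fsetU in_imfset.
have sub h : (forall x, h x = f x \/ h x = g x) ->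
    (h @` s `<=` f @` s `|` g @` s)%fset.
  move=> hfg; apply/fsubsetP => _ /imfsetP[x /= xs ->]; rewrite in_fsetU.
  by case: (hfg x) => ->; rewrite in_imfset ?orbT.
by rewrite fsubUset !sub.
Qed.

Lemma contiguous_simplicial f g : contiguous f g -> simplicial K L f.
Proof.
move=> fg s Ks; rewrite -[(f @` s)%fset]fsetUid.
by apply: (@contiguous_between f g) Ks => //; left.
Qed.

End Contiguity.

(** * Cones over tuples of vertices *)

Section Cone.
Variable Y : choiceType.

Definition cone n (w : Y) (t : {ffun 'I_n -> Y}) : {ffun 'I_n.+1 -> Y} :=
  [ffun i => oapp t w (unlift ord0 i)].

Lemma cone0 n w (t : {ffun 'I_n -> Y}) : cone w t ord0 = w.
Proof. by rewrite ffunE unlift_none. Qed.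

Lemma cone_lift n w (t : {ffun 'I_n -> Y}) i : cone w t (lift ord0 i) = t i.
Proof. by rewrite ffunE liftK. Qed.

Lemma vertices_cone n w (t : {ffun 'I_n -> Y}) :
  vertices (cone w t) = (w |` vertices t)%fset.
Proof.
apply/fsetP => y; rewrite in_fset1U; apply/verticesP/orP.
  case=> i; have [j ->|->] := unliftP ord0 i.
    by rewrite cone_lift => <-; right; exact: mem_vertices.
  by rewrite cone0 => ->; left.
case=> [/eqP->|/verticesP[i <-]]; first by exists ord0; rewrite cone0.
by exists (lift ord0 i); rewrite cone_lift.
Qed.

Lemma cone_not_injective n w (t : {ffun 'I_n -> Y}) :
  ~~ injectiveb t -> ~~ injectiveb (cone w t).
Proof.
move=> /injectivePn[i [j ij tij]]; apply/injectivePn.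
exists (lift ord0 i), (lift ord0 j); last by rewrite !cone_lift.
by rewrite (inj_eq lift_inj).
Qed.

Lemma face_cone0 (L : scomplex Y) n w (t : {ffun 'I_n.+1 -> Y})
    (u : osimplex L n.+1) :
  val u = cone w t -> val (face u ord0) = t.
Proof.
by move=> uE; apply/ffunP => i; rewrite ffunE -[osimplex_val u]/(val u) uE cone_lift.
Qed.

Lemma face_coneS (L : scomplex Y) n w (t : {ffun 'I_n.+2 -> Y})
    (u : osimplex L n.+2) i :
  val u = cone w t ->
  val (face u (lift ord0 i)) = cone w [ffun j => t (lift i j)].
Proof.
move=> uE; apply/ffunP => j; rewrite ffunE -[osimplex_val u]/(val u) uE.
have [l ->|->] := unliftP ord0 j; last first.
  rewrite cone0; have -> : lift (lift ord0 i) ord0 = ord0 by exact: val_inj.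
  by rewrite cone0.
rewrite cone_lift [RHS]ffunE.
have -> : lift (lift ord0 i) (lift ord0 l) = lift ord0 (lift i l).
  by apply: val_inj; rewrite /= /bump /= !add1n ltnS addnS.
by rewrite cone_lift.
Qed.

End Cone.

(** * Changing a simplicial map at one vertex *)

Section VertexMove.
Variables (k : fieldType) (X Y : choiceType).
Variables (K : scomplex X) (L : scomplex Y).
Variables (f g : X -> Y) (v : X).
Hypothesis fg : contiguous K L f g.
Hypothesis fg_off : forall x, x != v -> f x = g x.

Let fP := contiguous_simplicial fg.

Fact join_subproof n (t : osimplex K n) : v \in vertices t ->
  vertices (cone (g v) (osimplex_map fP t)) \in simplices L.
Proof.
move=> vt; apply/mem_set; rewrite vertices_cone.
apply: simplex_sub (fg (set_mem (osimplexP t))) _ _.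
  by apply/fset0Pn; exists (g v); rewrite in_fset1U eqxx.
apply/fsubsetP => y; rewrite in_fset1U in_fsetU => /orP[/eqP->|].
  by rewrite (in_imfset _ g) ?orbT.
by move=> /verticesP[i <-]; rewrite ffunE in_imfset //; exact: mem_vertices.
Qed.

Definition join n (t : osimplex K n) (vt : v \in vertices t) : osimplex L n.+1 :=
  OSimplex (join_subproof vt).

(** The one-vertex prism over [t].  Up to sign and the order of the vertices it
    is the only nondegenerate term of the usual prism, which is
    [[f t_0, ..., f v, g v, ..., g t_n]]; with the apex [g v] in front, the sign
    no longer depends on the position of [v] in [t]. *)
Definition oprism n (t : osimplex K n) : chains k L :=
  if pselect (v \in vertices t) is left vt then - oriented k (join vt) else 0.

Lemma oprism_in n (t : osimplex K n) (vt : v \in vertices t) :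
  oprism t = - oriented k (join vt).
Proof.
rewrite /oprism; case: pselect => // vt'.
by rewrite (bool_irrelevance vt vt').
Qed.

Lemma oprism_notin n (t : osimplex K n) : v \notin vertices t -> oprism t = 0.
Proof. by rewrite /oprism; case: pselect => // vt /negP[]. Qed.

Fact oprism_degenerate n (t : osimplex K n) : ~~ injectiveb t -> oprism t = 0.
Proof.
move=> tN; have [vt|vt] := boolP (v \in vertices t); last exact: oprism_notin.
rewrite (oprism_in vt) oriented_degenerate ?oppr0//; apply: cone_not_injective.
have /injectivePn[i [j ij tij]] := tN.
by apply/injectivePn; exists i, j; rewrite // !ffunE tij.
Qed.

Lemma vertices_operm n (t : osimplex K n) (s : 'S_n.+1) :
  vertices (operm t s) = vertices t.
Proof.
apply/fsetP => x; apply/verticesP/verticesP => -[i <-].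
  by exists (s i); rewrite ffunE.
by exists ((s^-1)%g i); rewrite ffunE permKV.
Qed.

Fact oprism_perm n (t : osimplex K n) (s : 'S_n.+1) :
  oprism (operm t s) = (-1) ^+ s *: oprism t.
Proof.
have [vt|vt] := boolP (v \in vertices t); last first.
  by rewrite !oprism_notin ?scaler0 ?vertices_operm.
have vts : v \in vertices (operm t s) by rewrite vertices_operm.
rewrite (oprism_in vt) (oprism_in vts) scalerN; congr (- _).
have -> : join vts = operm (join vt) (lift_perm ord0 ord0 s).
  apply: val_inj; apply/ffunP => i /=; rewrite [RHS]ffunE /=.
  have [j ->|->] := unliftP ord0 i.
    by rewrite lift_perm_lift !cone_lift !ffunE.
  by rewrite lift_perm_id !cone0.
by rewrite oriented_perm odd_lift_perm.
Qed.

Definition prism : chains k K -> chains k L :=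
  chains_lift oprism_degenerate oprism_perm.

HB.instance Definition _ := GRing.Linear.on prism.

Lemma prismE n (t : osimplex K n) : prism (oriented k t) = oprism t.
Proof. exact: chains_liftE. Qed.

Variable gP : simplicial K L g.

(** The two leading faces of the cone are [f t] and, since [v] is the head of
    [t], the simplex [g t].  The other faces are the cones over the faces of [t]
    that contain [v], which cancel against the prism of the boundary of [t]. *)
Lemma prism_homotopy_head n (t : osimplex K n) : injective t -> t ord0 = v ->
  boundary (prism (oriented k t)) + prism (boundary (oriented k t)) =
  chain_map k gP (oriented k t) - chain_map k fP (oriented k t).
Proof.
move=> tI t0; have vt : v \in vertices t by apply/verticesP; exists ord0.
rewrite prismE (oprism_in vt) !chain_mapE linearN /= !boundaryE /=.
have face0 : face (join vt) ord0 = osimplex_map fP t.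
  exact/val_inj/(@face_cone0 _ _ _ (g v)).
have face1 : face (join vt) (lift ord0 ord0) = osimplex_map gP t.
  apply: val_inj; apply/ffunP => i; rewrite !ffunE.
  have [j ->|->] := unliftP ord0 i.
    have -> : lift (lift ord0 ord0) (lift ord0 j) = lift ord0 (lift ord0 j) :> 'I_n.+2.
      by apply: val_inj.
    by rewrite liftK /= ffunE fg_off // -t0 (inj_eq tI) eq_sym neq_lift.
  have -> : lift (lift ord0 ord0) ord0 = ord0 :> 'I_n.+2 by exact: val_inj.
  by rewrite unlift_none t0.
rewrite 2!big_ord_recl face0 face1 !expr0 expr1 !scale1r scaleN1r.
set S := \sum_(i < n) _.
(* [S] collects the faces opposite to a vertex of [f t] other than [f v]. *)
suff -> : prism (oboundary k t) = S by rewrite !opprD opprK addrA subrK addrC.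
rewrite {}/S; case: n => [|n] in t tI t0 vt face0 face1 *.
  by rewrite big_ord0 linear0.
rewrite /= big_ord_recl !linearD /=.
(* The face opposite to the head of [t] does not contain [v]. *)
rewrite linearZ /= prismE oprism_notin ?scaler0 ?add0r; last first.
  apply/verticesP => -[i]; rewrite ffunE -t0 => /tI /eqP.
  by rewrite eq_sym (negbTE (neq_lift _ _)).
rewrite linear_sum; apply: eq_bigr => i _ /=.
have vti : v \in vertices (face t (lift ord0 i)).
  apply/verticesP; exists ord0; rewrite ffunE -t0.
  by congr (t _); exact: val_inj.
rewrite linearZ /= prismE (oprism_in vti) scalerN -scaleNr.
have -> : face (join vt) (lift ord0 (lift ord0 i)) = join vti.
  apply: val_inj; rewrite (@face_coneS _ _ _ (g v) (osimplex_map fP t)) //=.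
  by congr cone; apply/ffunP => j; rewrite !ffunE.
by congr (_ *: _); rewrite /bump /= !add1n [RHS]exprS mulN1r.
Qed.

(** Both sides of the identity are multiplied by a sign when the vertices of a
    simplex are permuted, so a simplex that contains [v] may be assumed to start
    with [v].  On a simplex that avoids [v], the prism vanishes and [f = g]. *)
Lemma prism_homotopy c :
  boundary (prism c) + prism (boundary c) = chain_map k gP c - chain_map k fP c.
Proof.
pose D : {linear chains k K -> chains k L} :=
  ((@boundary k Y L \o prism) \+ (prism \o @boundary k X K))
  \- (chain_map k gP \- chain_map k fP).
apply/eqP; rewrite -subr_eq0; apply/eqP.
apply: (@chains_linear_ext _ _ _ _ D \0) c => n t; rewrite [RHS]/=.
have [tI|/oriented_degenerate->] := boolP (injectiveb t); last first.
  by rewrite linear0.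
have [/verticesP[j tj]|vt] := boolP (v \in vertices t).
  pose s := tperm ord0 j.
  have D0 : D (oriented k (operm t s)) = 0.
    apply/eqP; rewrite subr_eq0; apply/eqP; apply: prism_homotopy_head.
      by move=> a b; rewrite !ffunE => /(injectiveP _ tI)/perm_inj.
    by rewrite ffunE tpermL.
  have := D0; rewrite oriented_perm linearZ => /eqP.
  by rewrite scaler_eq0 signr_eq0 => /eqP.
rewrite /= prismE oprism_notin// linear0 add0r !chain_mapE boundaryE.
have -> : osimplex_map gP t = osimplex_map fP t.
  apply: val_inj; apply/ffunP => i; rewrite !ffunE fg_off//.
  by apply: contraNneq vt => <-; exact: mem_vertices.
rewrite subrr subr0; case: n => [|n] in t tI vt *; rewrite /= ?linear0//.
rewrite linear_sum big1// => i _; rewrite linearZ /= prismE oprism_notin ?scaler0//.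
apply: contra vt => /verticesP[l]; rewrite ffunE => <-; exact: mem_vertices.
Qed.

End VertexMove.

(** * Contiguous maps induce the same map in homology *)

Section ContiguousHomology.
Variables (k : fieldType) (X Y : choiceType).
Variables (K : scomplex X) (L : scomplex Y).

Lemma homology_map_vertex_move (f g : X -> Y) v (fP : simplicial K L f)
    (gP : simplicial K L g) :
  contiguous K L f g -> (forall x, x != v -> f x = g x) ->
  homology_map k fP =1 homology_map k gP.
Proof.
move=> fg fg_off h; have [z ->] := homology_class_surj h.
rewrite !homology_mapE; apply/esym/homology_class_eqP.
exists (prism v fg (val z)); have := prism_homotopy fg fg_off gP (val z).
have /eqP-> := submod_valP z; rewrite linear0 addr0 => ->.
by rewrite (Prop_irrelevance (contiguous_simplicial fg) fP).
Qed.

(** Induction on the list of vertices where the maps may differ, each step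
    moving one more value from [f] to [g]. *)
Lemma homology_map_finite_move (f g : X -> Y) (s : seq X)
    (fP : simplicial K L f) (gP : simplicial K L g) :
  contiguous K L f g -> (forall x, x \notin s -> f x = g x) ->
  homology_map k fP =1 homology_map k gP.
Proof.
elim: s f fP => [|v s IH] f fP fg fgs h.
  have fE : f = g by apply/funext => x; exact: fgs.
  by rewrite fE in fP *; rewrite (Prop_irrelevance fP gP).
pose f' x := if x == v then g x else f x.
have f'_fg x : f' x = f x \/ f' x = g x by rewrite /f'; case: eqP; [right|left].
have ff' : contiguous K L f f' by apply: contiguous_between fg _ _ => // x; left.
have f'g : contiguous K L f' g by apply: contiguous_between fg _ _ => // x; right.
have f'P := contiguous_simplicial f'g.
rewrite (homology_map_vertex_move (v := v) fP f'P ff').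
  apply: IH => // x xs; rewrite /f'; case: eqVneq => // xv.
  by rewrite fgs // inE negb_or xv.
by move=> x xv; rewrite /f' (negbTE xv).
Qed.

(** An oriented chain has no canonical set of vertices, but the vertices of the
    simplices in any expression of [c] as a linear combination will do. *)
Lemma chain_map_finite_support (c : chains k K) :
  exists s : seq X, forall (f g : X -> Y) (fP : simplicial K L f)
    (gP : simplicial K L g), {in s, f =1 g} -> chain_map k fP c = chain_map k gP c.
Proof.
have [d ->] := quot_proj_surj c.
elim/freeg_ind_dom0: d => [|a [n t] d _ _ [s IH]].
  by exists [::] => f g fP gP _; rewrite !linear0.
exists ((vertices t : seq X) ++ s) => f g fP gP fg.
have -> : << a *g (Tagged (osimplex K) t : osimplices K) >> = a *: ordered k t.
  by apply/eqP/freeg_eqP => y; rewrite coeffZ !coeffU mul1r.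
rewrite !linearD !linearZ /= -/(oriented k t) !chain_mapE.
have -> : osimplex_map fP t = osimplex_map gP t.
  apply: val_inj; apply/ffunP => i; rewrite !ffunE; apply: fg.
  by rewrite mem_cat mem_vertices.
by congr (_ + _); apply: IH => x xs; apply: fg; rewrite mem_cat xs orbT.
Qed.

(** On the finitely many vertices of a cycle, [g] agrees with the map [g'] that
    equals [g] there and [f] elsewhere, and [g'] differs from [f] only at
    finitely many vertices. *)
Theorem homology_map_contiguous (f g : X -> Y) (fP : simplicial K L f)
    (gP : simplicial K L g) :
  contiguous K L f g -> homology_map k fP =1 homology_map k gP.
Proof.
move=> fg h; have [z ->] := homology_class_surj h.
have [s sE] := chain_map_finite_support (val z).
pose g' x := if x \in s then g x else f x.
have g'_fg x : g' x = f x \/ g' x = g x by rewrite /g'; case: ifP; [right|left].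
have fg' : contiguous K L f g' by apply: contiguous_between fg _ _ => // x; left.
have g'g : contiguous K L g' g by apply: contiguous_between fg _ _ => // x; right.
have g'P := contiguous_simplicial g'g.
rewrite (homology_map_finite_move (s := s) fP g'P fg').
  rewrite !homology_mapE; congr homology_class; apply: val_inj => /=.
  by apply: sE => x xs; rewrite /g' xs.
by move=> x xs; rewrite /g' (negbTE xs).
Qed.

End ContiguousHomology.

(** * Maps of Vietoris-Rips filtrations *)

Section RipsMaps.
Variables (R : realType) (k : fieldType).

Definition almost_short (X Y : metricType R) (e : R) (f : X -> Y) : Prop :=
  forall x x', mdist (f x) (f x') <= mdist x x' + e.

Lemma almost_short_simplicial (X Y : metricType R) e (f : X -> Y) (a : R) :
  almost_short e f -> simplicial (rips X a) (rips Y (a + e)) f.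
Proof.
move=> fe s [s0 sa]; split.
  by have /fset0Pn[x xs] := s0; apply/fset0Pn; exists (f x); rewrite in_imfset.
move=> _ _ /imfsetP[x /= xs ->] /imfsetP[y /= ys ->].
by rewrite (le_trans (fe x y))// lerD2r sa.
Qed.

Section RipsHom.
Variables (X Y : metricType R) (e : R) (f : X -> Y) (fe : almost_short e f).

Definition rips_hom_fun (a : R) :
    {linear homology k (rips X a) -> homology k (rips Y (a + e))} :=
  homology_map k (almost_short_simplicial (a := a) fe).

Fact rips_hom_natural (a b : R) (ab : a <= b) (ab_e : a + e <= b + e) u :
  pm_map (homology_persmod k (filtered_rips Y)) ab_e (rips_hom_fun a u) =
  rips_hom_fun b (pm_map (homology_persmod k (filtered_rips X)) ab u).
Proof.
have fP : simplicial (rips X a) (rips Y (b + e)) f.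
  move=> s sa; apply: (almost_short_simplicial fe).
  exact: rips_mono ab _ sa.
transitivity (homology_map k fP u); first exact: homology_map_comp.
exact/esym/homology_map_comp.
Qed.

Definition rips_hom :
    pm_hom e (homology_persmod k (filtered_rips X))
             (homology_persmod k (filtered_rips Y)) :=
  @PmHom R k e (homology_persmod k (filtered_rips X))
    (homology_persmod k (filtered_rips Y)) rips_hom_fun rips_hom_natural.

End RipsHom.

(** The hypothesis on [g \o f] bounds the distances between a vertex of a simplex
    and the image of another one; together with the two bounds on the diameters
    of the simplex and of its image, it makes [g \o f] contiguous to the
    inclusion. *)
Lemma rips_hom_comp (X Y : metricType R) e (f : X -> Y) (g : Y -> X)
    (fe : almost_short e f) (ge : almost_short e g) :
  (forall x x', mdist x (g (f x')) <= mdist x x' + e + e) ->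
  forall a (a2e : a <= a + e + e) u,
    rips_hom ge (a + e) (rips_hom fe a u) =
    pm_map (homology_persmod k (filtered_rips X)) a2e u.
Proof.
move=> gf a a2e u.
have gfP : simplicial (rips X a) (rips X (a + e + e)) (g \o f).
  move=> s sa; rewrite imfset_comp; apply: (almost_short_simplicial ge).
  exact: almost_short_simplicial.
transitivity (homology_map k gfP u); first exact: homology_map_comp.
apply: homology_map_contiguous => s [s0 sa]; split.
  by have /fset0Pn[x xs] := s0; apply/fset0Pn; exists x; rewrite in_fsetU imfset_id xs orbT.
have gfe x x' : mdist (g (f x)) (g (f x')) <= mdist x x' + e + e.
  by rewrite (le_trans (ge _ _))// lerD2r.
have sae x x' : x \in s -> x' \in s -> mdist x x' + e + e <= a + e + e.
  by move=> xs x's; rewrite !lerD2r sa.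
move=> x y; rewrite !in_fsetU !imfset_id.
case/orP=> [/imfsetP[x' /= x's ->]|xs]; case/orP=> [/imfsetP[y' /= y's ->]|ys].
- exact: le_trans (gfe _ _) (sae _ _ _ _).
- by rewrite metric_sym; exact: le_trans (gf _ _) (sae _ _ _ _).
- exact: le_trans (gf _ _) (sae _ _ _ _).
- by rewrite (le_trans (sa _ _ _ _)).
Qed.

End RipsMaps.

(** * Correspondences of small distortion *)

Section Correspondences.
Variables (R : realType) (X Y : metricType R).

Lemma distortion_le (C : set (X * Y)) (e : R) x y x' y' :
  (distortion C < e%:E)%E -> C (x, y) -> C (x', y') ->
  mdist x x' <= mdist y y' + e /\ mdist y y' <= mdist x x' + e.
Proof.
move=> Ce xy x'y'.
suff : `|mdist x x' - mdist y y'| <= e.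
  by rewrite ler_distl lerBlDr => /andP[].
rewrite -lee_fin; apply: le_trans (ltW Ce); apply: ereal_sup_ubound; right.
by exists (x, y) => //; exists (x', y').
Qed.

Lemma dGH_correspondence (e : R) : (2%:E * dGH X Y < e%:E)%E ->
  exists2 C : set (X * Y), correspondence C & (distortion C < e%:E)%E.
Proof.
rewrite /dGH muleA -EFinM divff ?pnatr_eq0// mul1e => /ereal_inf_lt[_ [C CP <-] Ce].
by exists C.
Qed.

Lemma distortion_ge0 (C : set (X * Y)) : (0 <= distortion C)%E.
Proof. by apply: ereal_sup_ubound; left. Qed.

End Correspondences.

Theorem lemma4p3 (R : realType) (k : fieldType) (X Y : metricType R) (e : R) :
  (2%:E * dGH X Y < e%:E)%E ->
  interleaved e (homology_persmod k (filtered_rips X))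
                (homology_persmod k (filtered_rips Y)).
Proof.
move=> /dGH_correspondence[C [/choice[f fC] /choice[g gC]] Ce].
have e0 : 0 <= e by rewrite -lee_fin (le_trans (distortion_ge0 C))// ltW.
have fe : almost_short e f.
  by move=> x x'; have [] := distortion_le Ce (fC x) (fC x').
have ge : almost_short e g.
  by move=> y y'; have [] := distortion_le Ce (gC y) (gC y').
split=> //; exists (rips_hom k fe), (rips_hom k ge); split.
  apply: rips_hom_comp => // x x'.
  have [+ _] := distortion_le Ce (fC x) (gC (f x')).
  by move=> /le_trans; apply; rewrite lerD2r.
apply: rips_hom_comp => // y y'.
have [_] := distortion_le Ce (gC y) (fC (g y')).
by move=> /le_trans; apply; rewrite lerD2r.
Qed.
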